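(* Let $N,d,k\in\mathbb{N}$ with $k\le d$, let $T>0$, and let $a:[0,\infty)\to(0,\infty)$ be non-increasing and Lipschitz with Lipschitz constant $L_a$. Let $\delta>0$, $\varepsilon\in(0,1)$ and $M\in\mathbb{R}^{k\times d}$. Let $(x(t),v(t))\in(\mathbb{R}^d)^N\times(\mathbb{R}^d)^N$ be the solution of the Cucker--Smale system $$\dot x_i(t)=v_i(t),\qquad \dot v_i(t)=\frac1N\sum_{j=1}^N a(\|x_i(t)-x_j(t)\|)\,(v_j(t)-v_i(t)),\qquad i=1,\dots,N,$$ with initial condition $(x(0),v(0))$, and let $(y(t),w(t))\in(\mathbb{R}^k)^N\times(\mathbb{R}^k)^N$ be the solution of $$\dot y_i(t)=w_i(t),\qquad \dot w_i(t)=\frac1N\sum_{j=1}^N a(\|y_i(t)-y_j(t)\|)\,(w_j(t)-w_i(t)),\qquad i=1,\dots,N,$$ with initial condition $y_i(0)=Mx_i(0)$, $w_i(0)=Mv_i(0)$, $i=1,\dots,N$. Assume that $M$ has the weak Johnson--Lindenstrauss property of parameters $\varepsilon$ and $\delta$ at the vectors $x_i(t)-x_j(t)$ for all $t\in[0,T]$ and all $i,j\in\{1,\dots,N\}$. Define $e_i^x(t)=\|y_i(t)-Mx_i(t)\|$, $e_i^v(t)=\|w_i(t)-Mv_i(t)\|$, and $$\mathcal{E}^x(t)=\max_{i}e_i^x(t),\quad \mathcal{E}^v(t)=\max_{i}e_i^v(t),\quad \mathcal{E}_2^x(t)=\Big(\frac1N\sum_{i=1}^N e_i^x(t)^2\Big)^{1/2},\quad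 \mathcal{E}_2^v(t)=\Big(\frac1N\sum_{i=1}^N e_i^v(t)^2\Big)^{1/2}.$$ Set $K_1:=L_a\sqrt{NW(0)}\sqrt{2X(0)}$, $K_2:=2L_a\sqrt{NW(0)}$, $K_3:=\frac12 L_a\sqrt{NW(0)}\sqrt{2V(0)}$ and $$\mathcal{K}=\begin{pmatrix}2a(0)&2L_a\sqrt{NW(0)}\\1&0\end{pmatrix}.$$ Then for all $t\in[0,T]$ $$\mathcal{E}^x(t)+\mathcal{E}^v(t)\le\sqrt N\,\big((\varepsilon K_1+\delta K_2)t+\varepsilon K_3t^2\big)\,e^{t\|\mathcal{K}\|_{\ell_1\to\ell_1}},$$ $$\mathcal{E}_2^x(t)+\mathcal{E}_2^v(t)\le\big((\varepsilon K_1+\delta K_2)t+\varepsilon K_3t^2\big)\,e^{t\|\mathcal{K}\|_{\ell_1\to\ell_1}},$$ and moreover $$\mathcal{E}^v(t)\le\sqrt N\,\min\Big\{\big((\varepsilon K_1+\delta K_2)t+\varepsilon K_3t^2\big)\,e^{t\|\mathcal{K}\|_{\ell_1\to\ell_1}},\ \|M\|\sqrt{V(t)}+\sqrt{W(t)}\Big\}.$$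
   Context: $\|\cdot\|$ is the Euclidean norm on vectors and the induced operator norm ($\ell_2^d\to\ell_2^k$) on matrices; $\|\mathcal{K}\|_{\ell_1\to\ell_1}$ is the operator norm on $\mathbb{R}^2$ induced by the $\ell_1$-norm. Notation: $X(t)=\frac1{2N^2}\sum_{i,j}\|x_i(t)-x_j(t)\|^2$, $V(t)=\frac1{2N^2}\sum_{i,j}\|v_i(t)-v_j(t)\|^2$, and $W(t)=\frac1{2N^2}\sum_{i,j}\|w_i(t)-w_j(t)\|^2$. Weak Johnson--Lindenstrauss property: for $\delta>0$, $\varepsilon\in(0,1)$, a matrix $M\in\mathbb{R}^{k\times d}$ has the weak Johnson--Lindenstrauss property of parameters $\varepsilon$ and $\delta$ at $x\in\mathbb{R}^d$ if either $(1-\varepsilon)\|x\|\le\|Mx\|\le(1+\varepsilon)\|x\|$, or ($\|x\|\le\delta$ and $\|Mx\|\le\delta$) (the two alternatives need not be exclusive). *)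

(* Defs.v *)
From HB Require Import structures.
From mathcomp Require Import all_boot all_order all_algebra.
From mathcomp Require Import all_classical all_reals all_analysis.

Set Implicit Arguments.
Unset Strict Implicit.
Unset Printing Implicit Defensive.

Import Order.TTheory GRing.Theory Num.Theory.
Import numFieldNormedType.Exports.

Local Open Scope classical_set_scope.
Local Open Scope ring_scope.

(* The norm `|x| of MathComp-Analysis on 'cV[R]_n is the sup norm, hence the
   explicit Euclidean and l1 norms below. *)

Definition l2norm {R : realType} {n : nat} (x : 'cV[R]_n) : R :=
  Num.sqrt (\sum_(i < n) x i 0 ^+ 2).

Definition l1norm {R : realType} {n : nat} (x : 'cV[R]_n) : R :=
  \sum_(i < n) `|x i 0|.

Definition induced_norm {R : realType} {m n : nat}
    (normE : 'cV[R]_n -> R) (normF : 'cV[R]_m -> R) (A : 'M[R]_(m, n)) : R :=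
  sup [set normF (A *m x) | x in [set x | normE x <= 1]].

Definition l2_opnorm {R : realType} {m n : nat} (A : 'M[R]_(m, n)) : R :=
  induced_norm l2norm l2norm A.

Definition l1_opnorm {R : realType} {m n : nat} (A : 'M[R]_(m, n)) : R :=
  induced_norm l1norm l1norm A.

(* f'(t) = df with difference quotients taken inside A: the two-sided
   derivative at interior points of A, a one-sided one at the end points of an
   interval.  In finite dimension the limit does not depend on the norm, so
   using the topology of the sup norm on 'cV[R]_n is harmless. *)
Definition has_derivative_within {R : realType} {V : normedModType R}
    (A : set R) (f : R -> V) (t : R) (df : V) : Prop :=
  (fun s => (s - t)^-1 *: (f s - f t)) @ within A t^' --> df.

Definition cucker_smale_solution {R : realType} {N d : nat} (a : R -> R)
    (x v : R -> 'I_N -> 'cV[R]_d) : Prop :=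
  forall (t : R) (i : 'I_N), 0 <= t ->
    has_derivative_within `[0, +oo[ (fun s => x s i) t (v t i) /\
    has_derivative_within `[0, +oo[ (fun s => v s i) t
      (N%:R^-1 *: \sum_(j < N)
         a (l2norm (x t i - x t j)) *: (v t j - v t i)).

Definition mean_sq_dist {R : realType} {N d : nat} (u : 'I_N -> 'cV[R]_d) : R :=
  (2 * N%:R ^+ 2)^-1 * \sum_(i < N) \sum_(j < N) l2norm (u i - u j) ^+ 2.

Definition weak_JL {R : realType} {k d : nat} (eps delta : R)
    (M : 'M[R]_(k, d)) (x : 'cV[R]_d) : Prop :=
  (1 - eps) * l2norm x <= l2norm (M *m x) <= (1 + eps) * l2norm x \/
  (l2norm x <= delta /\ l2norm (M *m x) <= delta).

Definition proj_error {R : realType} {N k d : nat} (M : 'M[R]_(k, d))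
    (y : 'I_N -> 'cV[R]_k) (x : 'I_N -> 'cV[R]_d) (i : 'I_N) : R :=
  l2norm (y i - M *m x i).

(* Since proj_error is nonnegative, starting the maximum from 0 does not
   change its value when 0 < N. *)
Definition max_error {R : realType} {N k d : nat} (M : 'M[R]_(k, d))
    (y : 'I_N -> 'cV[R]_k) (x : 'I_N -> 'cV[R]_d) : R :=
  \big[Num.max/0]_(i < N) proj_error M y x i.

Definition rms_error {R : realType} {N k d : nat} (M : 'M[R]_(k, d))
    (y : 'I_N -> 'cV[R]_k) (x : 'I_N -> 'cV[R]_d) : R :=
  Num.sqrt (N%:R^-1 * \sum_(i < N) proj_error M y x i ^+ 2).

Definition mx22 {R : realType} (p q r s : R) : 'M[R]_2 :=
  \matrix_(i, j) if i == 0 then (if j == 0 then p else q)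
                 else (if j == 0 then r else s).

(* Main.v *)
(* Let P and Q be the root mean squares of the errors y_i - M x_i and
   w_i - M v_i.  Then P' <= Q.  In Q', the part of the force difference that
   aligns the errors w_i - M v_i with the kernel a(|x_i - x_j|) is dissipative;
   the remaining part carries the factor
     |a(|y_i - y_j|) - a(|x_i - x_j|)|
       <= La (e_i + e_j + eps |x_i - x_j| + delta),
   and Cauchy-Schwarz over the pairs (i, j), together with
   sum_j |w_i - w_j|^2 <= N^2 W for every single i, yields
     Q' <= La sqrt(N W) (2 P + eps sqrt(2 X) + delta).
   Since W is non-increasing and sqrt X grows at most linearly with slope
   sqrt (V 0), Gronwall's inequality bounds P + Q; the l1 operator norm of K,
   the largest column sum, dominates both rates of the coupled system.
   The last bound holds because w_i - M v_i has mean zero for all times. *)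

Require Import Defs.
From HB Require Import structures.
From mathcomp Require Import all_boot all_order all_algebra.
From mathcomp Require Import all_classical all_reals all_analysis.
From mathcomp Require Import ring lra.

Set Implicit Arguments.
Unset Strict Implicit.
Unset Printing Implicit Defensive.

Import Order.TTheory GRing.Theory Num.Theory.
Import numFieldNormedType.Exports.

Local Open Scope classical_set_scope.
Local Open Scope ring_scope.

(** * Euclidean norms and operator norms *)

(** An arbitrary finite index type lets one Cauchy-Schwarz and one Minkowski inequality serve
    coordinates, agents and pairs of agents alike. *)
Definition enorm {R : realType} {I : finType} (f : I -> R) : R :=
  Num.sqrt (\sum_i f i ^+ 2).

Lemma enorm_ge0 (R : realType) (I : finType) (f : I -> R) : 0 <= enorm f.
Proof. exact: sqrtr_ge0. Qed.

Lemma sqr_enorm (R : realType) (I : finType) (f : I -> R) :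
  enorm f ^+ 2 = \sum_i f i ^+ 2.
Proof. by rewrite sqr_sqrtr// sumr_ge0// => i _; rewrite sqr_ge0. Qed.

Lemma sqr_l2norm (R : realType) (n : nat) (x : 'cV[R]_n) :
  l2norm x ^+ 2 = \sum_(i < n) x i 0 ^+ 2.
Proof. exact: (sqr_enorm (fun i => x i 0)). Qed.

Lemma l2norm_ge0 (R : realType) (n : nat) (x : 'cV[R]_n) : 0 <= l2norm x.
Proof. exact: sqrtr_ge0. Qed.

(** With [A], [B] the two norms and [C] the inner product, the squares of [B^2 f_i - C g_i] sum to
    [B^2 (A^2 B^2 - C^2)], which is therefore nonnegative; one divides by [B^2] unless [g]
    vanishes. *)
Lemma cauchy_schwarz (R : realType) (I : finType) (f g : I -> R) :
  \sum_i f i * g i <= enorm f * enorm g.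
Proof.
move CE : (\sum_i f i * g i) => C; set A := enorm f; set B := enorm g.
have A0 : 0 <= A := enorm_ge0 f; have B0 : 0 <= B := enorm_ge0 g.
have expand : \sum_i (B ^+ 2 * f i - C * g i) ^+ 2 =
    B ^+ 2 * (A ^+ 2 * B ^+ 2 - C ^+ 2).
  transitivity (B ^+ 4 * (\sum_i f i ^+ 2) - 2 * B ^+ 2 * C * (\sum_i f i * g i)
      + C ^+ 2 * (\sum_i g i ^+ 2)).
    rewrite !mulr_sumr -sumrB -big_split/=.
    by apply: eq_bigr => i _; ring.
  by rewrite -!sqr_enorm -/A -/B CE; ring.
have key : 0 <= B ^+ 2 * (A ^+ 2 * B ^+ 2 - C ^+ 2).
  by rewrite -expand sumr_ge0// => i _; rewrite sqr_ge0.
have [B_eq0|B_neq0] := eqVneq B 0.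
  suff -> : C = 0 by rewrite B_eq0 mulr0.
  rewrite -CE.
  have : \sum_i g i ^+ 2 = 0 by rewrite -sqr_enorm -/B B_eq0 expr0n.
  move=> /psumr_eq0P g0; apply: big1 => i _.
  have /eqP := g0 (fun j _ => sqr_ge0 (g j)) i isT.
  by rewrite sqrf_eq0 => /eqP ->; rewrite mulr0.
have [C0|C0] := ltP C 0; first by rewrite (le_trans (ltW C0))// mulr_ge0.
have B2 : 0 < B ^+ 2 by rewrite exprn_gt0// lt_neqAle eq_sym B_neq0.
rewrite -(@ler_pXn2r _ 2)// ?nnegrE ?mulr_ge0//.
by move: key; rewrite pmulr_rge0// subr_ge0 exprMn.
Qed.

Lemma ler_enorm (R : realType) (I : finType) (f g : I -> R) :
  (forall i, `|f i| <= g i) -> enorm f <= enorm g.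
Proof.
move=> fg; apply: ler_wsqrtr; apply: ler_sum => i _.
rewrite -real_normK ?num_real// ler_pXn2r ?nnegrE//.
exact: le_trans (normr_ge0 _) (fg i).
Qed.

Lemma ler_enormD (R : realType) (I : finType) (f g : I -> R) :
  enorm (fun i => f i + g i) <= enorm f + enorm g.
Proof.
rewrite -(@ler_pXn2r _ 2) ?nnegrE ?addr_ge0 ?enorm_ge0//.
have -> : enorm (fun i => f i + g i) ^+ 2 =
    enorm f ^+ 2 + 2 * (\sum_i f i * g i) + enorm g ^+ 2.
  rewrite !sqr_enorm mulr_sumr -!big_split/=.
  apply: eq_bigr => i _; ring.
have := cauchy_schwarz f g; nra.
Qed.

Lemma ler_enorm_coord (R : realType) (I : finType) (f : I -> R) (i : I) :
  `|f i| <= enorm f.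
Proof.
rewrite -sqrtr_sqr; apply: ler_wsqrtr; rewrite (bigD1 i)//= lerDl.
by apply: sumr_ge0 => j _; rewrite sqr_ge0.
Qed.

Lemma enormZ (R : realType) (I : finType) (c : R) (f : I -> R) :
  0 <= c -> enorm (fun i => c * f i) = c * enorm f.
Proof.
move=> c0; apply/eqP; rewrite -(@eqrXn2 _ 2) ?mulr_ge0 ?enorm_ge0//.
rewrite exprMn !sqr_enorm mulr_sumr; apply/eqP; apply: eq_bigr => i _.
by rewrite exprMn.
Qed.

Lemma enorm_pair (R : realType) (I J : finType) (f : I -> J -> R) :
  enorm (fun p : I * J => f p.1 p.2) = enorm (fun i => enorm (f i)).
Proof.
congr Num.sqrt; under [RHS]eq_bigr do rewrite sqr_enorm.
by rewrite pair_bigA.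
Qed.

Lemma enorm_cst (R : realType) (I : finType) (c : R) :
  0 <= c -> enorm (fun _ : I => c) = Num.sqrt #|I|%:R * c.
Proof.
move=> c0; rewrite /enorm sumr_const -[_ *+ _]mulr_natl sqrtrM ?ler0n//.
by rewrite sqrtr_sqr ger0_norm.
Qed.

Lemma ler_l2normD (R : realType) (n : nat) (x y : 'cV[R]_n) :
  l2norm (x + y) <= l2norm x + l2norm y.
Proof.
have := ler_enormD (fun i => x i 0) (fun i => y i 0); apply: le_trans.
by rewrite le_eqVlt; apply/orP; left; apply/eqP; congr Num.sqrt;
  apply: eq_bigr => i _; rewrite !mxE.
Qed.

Lemma l2normN (R : realType) (n : nat) (x : 'cV[R]_n) : l2norm (- x) = l2norm x.
Proof. by congr Num.sqrt; apply: eq_bigr => i _; rewrite mxE sqrrN. Qed.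

Lemma l2norm_distC (R : realType) (d : nat) (x y : 'cV[R]_d) :
  l2norm (x - y) = l2norm (y - x).
Proof. by rewrite -opprB l2normN. Qed.

Lemma l2normZ (R : realType) (n : nat) (c : R) (x : 'cV[R]_n) :
  l2norm (c *: x) = `|c| * l2norm x.
Proof.
rewrite -[RHS](enormZ (fun i => x i 0))//; congr Num.sqrt.
by apply: eq_bigr => i _; rewrite mxE !exprMn real_normK ?num_real.
Qed.

Lemma l2norm0 (R : realType) (n : nat) : l2norm (0 : 'cV[R]_n) = 0.
Proof. by rewrite -(scale0r (0 : 'cV[R]_n)) l2normZ normr0 mul0r. Qed.

Lemma ler_l2norm_dist (R : realType) (n : nat) (x y : 'cV[R]_n) :
  `|l2norm x - l2norm y| <= l2norm (x - y).
Proof.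
have xy := ler_l2normD (x - y) y; have yx := ler_l2normD (y - x) x.
rewrite subrK in xy; rewrite subrK -opprB l2normN in yx.
by rewrite ler_norml; lra.
Qed.

Lemma ler_l2norm_sum (R : realType) (n : nat) (I : finType) (F : I -> 'cV[R]_n) :
  l2norm (\sum_i F i) <= \sum_i l2norm (F i).
Proof.
elim/big_ind2 : _ => [|p P q Q hp hq|//]; first by rewrite l2norm0.
exact: le_trans (ler_l2normD _ _) (lerD hp hq).
Qed.

Lemma enormN (R : realType) (I : finType) (f : I -> R) :
  enorm (fun i => - f i) = enorm f.
Proof. by congr Num.sqrt; apply: eq_bigr => i _; rewrite sqrrN. Qed.

Lemma cauchy_schwarz_abs (R : realType) (I : finType) (f g : I -> R) :
  `|\sum_i f i * g i| <= enorm f * enorm g.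
Proof.
rewrite ler_norml cauchy_schwarz andbT lerNl -sumrN -enormN.
under eq_bigr do rewrite -mulNr.
exact: cauchy_schwarz.
Qed.

(** The constant is the Frobenius norm of [A]. It serves to show that the supremum defining
    [l2_opnorm] is taken over a bounded set. *)
Lemma l2norm_mulmx (R : realType) (m n : nat) (A : 'M[R]_(m, n)) (x : 'cV[R]_n) :
  l2norm (A *m x) <= enorm (fun i => enorm (A i)) * l2norm x.
Proof.
rewrite mulrC -enormZ ?l2norm_ge0//; apply: ler_enorm => i.
by rewrite mxE mulrC; exact: cauchy_schwarz_abs.
Qed.

Lemma l2_opnorm_has_ub (R : realType) (m n : nat) (A : 'M[R]_(m, n)) :
  has_ubound [set l2norm (A *m z) | z in [set z | l2norm z <= 1]].
Proof.
exists (enorm (fun i => enorm (A i))) => _ [z /= z1 <-].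
by rewrite (le_trans (l2norm_mulmx _ _))// ler_piMr ?enorm_ge0.
Qed.

Lemma l2_opnorm_ge0 (R : realType) (m n : nat) (A : 'M[R]_(m, n)) :
  0 <= l2_opnorm A.
Proof.
apply: (ub_le_sup (l2_opnorm_has_ub A)).
by exists 0; rewrite /= ?mulmx0 l2norm0.
Qed.

Lemma l2_opnormP (R : realType) (m n : nat) (A : 'M[R]_(m, n)) (x : 'cV[R]_n) :
  l2norm (A *m x) <= l2_opnorm A * l2norm x.
Proof.
(* A vector of norm zero cannot be normalised; there the Frobenius bound gives zero on both
   sides. *)
have [x0|x_neq0] := eqVneq (l2norm x) 0.
  by have := l2norm_mulmx A x; rewrite x0 !mulr0.
have x_gt0 : 0 < l2norm x by rewrite lt_neqAle eq_sym x_neq0 l2norm_ge0.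
rewrite -ler_pdivrMr//; apply: (ub_le_sup (l2_opnorm_has_ub A)).
exists ((l2norm x)^-1 *: x) => /=.
  by rewrite l2normZ gtr0_norm ?invr_gt0// mulVf.
by rewrite -scalemxAr l2normZ gtr0_norm ?invr_gt0// mulrC.
Qed.

(** The unit vector with index [j] is mapped to column [j], so each column sum, here [p + 1] and
    [q], is a lower bound for the norm. *)
Lemma l1_opnorm_mx22 (R : realType) (p q : R) : 0 <= p -> 0 <= q ->
  1 <= l1_opnorm (mx22 p q 1 0) /\ q <= l1_opnorm (mx22 p q 1 0).
Proof.
move=> p0 q0; set A := mx22 p q 1 0.
have ubA : has_ubound [set l1norm (A *m z) | z in [set z | l1norm z <= 1]].
  exists (\sum_i \sum_j `|A i j|) => _ [z /= z1 <-].
  apply: ler_sum => i _; rewrite mxE.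
  apply: le_trans (ler_norm_sum _ _ _) _; apply: ler_sum => j _.
  rewrite normrM ler_piMr//; apply: le_trans z1.
  by rewrite /l1norm (bigD1 j)//= lerDl sumr_ge0.
have col j : l1norm (A *m delta_mx j 0) = \sum_i `|A i j|.
  by apply: eq_bigr => i _; rewrite -colE mxE.
have unit j : l1norm (delta_mx j 0 : 'cV[R]_2) <= 1.
  rewrite /l1norm (bigD1 j)//= big1 ?addr0 ?mxE ?eqxx ?normr1// => i ij.
  by rewrite mxE (negbTE ij) normr0.
have le_col j : \sum_i `|A i j| <= l1_opnorm A.
  by rewrite -col; apply: ub_le_sup => //; exists (delta_mx j 0) => //=.
have := (le_col 0, le_col 1); rewrite !big_ord_recl !big_ord0 !mxE/=.
rewrite !ger0_norm// => -[]; lra.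
Qed.

(** * Differential inequalities *)

(* The affine extension to negative times turns the one-sided derivative at 0
   into a two-sided one. *)
Lemma is_derive_extend (R : realType) (f df : R -> R) :
  (forall t : R, 0 <= t -> has_derivative_within `[0, +oo[ f t (df t)) ->
  forall t : R, 0 <= t ->
  is_derive t 1 (fun s => if 0 <= s then f s else f 0 + s * df 0) (df t).
Proof.
move=> fdf t t0; set g := fun s => _.
suff cvgt : (fun h => h^-1 *: ((g \o shift t) (h *: 1) - g t)) @ 0^' --> df t.
  by split; [apply/cvg_ex; exists (df t)|exact: cvg_lim].
apply/cvgrPdist_lt => e e0.
have /cvgrPdist_lt/(_ _ e0) := fdf _ t0.
rewrite near_withinE => /nbhs_ballP[r /= r0 rP].
(* For positive [t] the radius is shrunk to at most [t], so that [h + t] can be negative only when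
   [t = 0]; there the affine branch has difference quotient exactly [df 0]. *)
have [r' r'0 r'P] : exists2 r', 0 < r' & r' <= r /\ (0 < t -> r' <= t).
  have [->|tn0] := eqVneq t 0; first by exists r => //; split => //; rewrite ltxx.
  exists (Num.min r t); first by rewrite lt_min r0 lt_neqAle eq_sym tn0.
  by rewrite !ge_min !lexx orbT.
apply/nbhs_ballP; exists r' => //= h; rewrite /ball/= sub0r normrN => hr' h0.
rewrite /g /= [h *: 1]mulr1 t0.
have [th0|th0] := leP 0 (h + t).
  have := rP (h + t); rewrite addrK; apply => //.
  - by rewrite /ball/= opprD addrCA subrr addr0 normrN (lt_le_trans hr')//; case: r'P.
  - by rewrite -subr_eq0 addrK.
  - by rewrite /= in_itv/= th0.
have t_eq0 : t = 0.
  apply/eqP; rewrite -(negbK (t == 0)); apply/negP => tn0.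
  have /r'P.2 r't : 0 < t by rewrite lt_neqAle eq_sym tn0.
  by move: hr'; rewrite ltr_norml; lra.
rewrite t_eq0 addr0 addrAC subrr add0r [_ *: _]mulrA mulVf// mul1r subrr.
by rewrite normr0.
Qed.

Lemma has_derivative_within_coord (R : realType) (n : nat) (A : set R)
    (f : R -> 'cV[R]_n) (t : R) (df : 'cV[R]_n) (c : 'I_n) :
  has_derivative_within A f t df ->
  has_derivative_within A (fun s => f s c 0) t (df c 0).
Proof.
move=> fdf; rewrite /has_derivative_within.
have -> : (fun s => (s - t)^-1 *: (f s c 0 - f t c 0)) =
    (fun M : 'cV[R]_n => M c 0) \o (fun s => (s - t)^-1 *: (f s - f t)).
  by apply/funext => s /=; rewrite !mxE.
apply: continuous_cvg fdf; exact: coord_continuous.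
Qed.

Lemma derive_le0_le (R : realType) (f df : R -> R) (T : R) :
  (forall t : R, 0 <= t <= T -> is_derive t 1 f (df t)) ->
  (forall t : R, 0 <= t <= T -> df t <= 0) ->
  forall t : R, 0 <= t <= T -> f t <= f 0.
Proof.
move=> fdf df0 t /andP[t0 tT].
have [||c cI E] := @MVT_segment _ f df 0 t t0.
- by move=> s; rewrite in_itv/= => /andP[s0 st]; apply: fdf; lra.
- apply/continuous_in_subspaceT => s /set_mem; rewrite /= in_itv/= => /andP[s0 st].
  apply/differentiable_continuous/derivable1_diffP.
  by have [] := fdf s ltac:(lra).
- move: cI; rewrite in_itv/= => /andP[c0 ct].
  have : df c * (t - 0) <= 0.
    by rewrite subr0 mulr_le0_ge0// df0// c0 (le_trans ct).
  by rewrite -E subr_le0.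
Qed.

(** The shift by [eta ^+ 2] keeps the radicand positive, so the root is differentiable even where
    [p] vanishes. *)
Lemma is_derive_sqrt_shift (R : realType) (p : R -> R) (dp t eta : R) :
  0 <= p t -> 0 < eta -> is_derive t 1 p dp ->
  is_derive t 1 (fun s => Num.sqrt (p s + eta ^+ 2))
    ((2 * Num.sqrt (p t + eta ^+ 2))^-1 * dp).
Proof.
move=> p0 eta0 pdp; pose q s := p s + eta ^+ 2.
have qt0 : 0 < q t by rewrite ltr_wpDl// exprn_gt0.
apply: (@is_derive1_comp _ Num.sqrt q); first exact: is_derive1_sqrt.
by rewrite -[dp]addr0; apply: (is_deriveD pdp); exact: is_derive_cst.
Qed.

Lemma sqrt_shift_ge (R : realType) (p eta : R) :
  Num.sqrt p <= Num.sqrt (p + eta ^+ 2).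
Proof. by rewrite ler_wsqrtr// lerDl sqr_ge0. Qed.

Lemma sqrt_shift_le (R : realType) (p eta : R) : 0 <= p -> 0 < eta ->
  Num.sqrt (p + eta ^+ 2) <= Num.sqrt p + eta.
Proof.
move=> p0 eta0; have := sqr_sqrtr p0; have := sqrtr_ge0 p.
set s := Num.sqrt p => s0 sE.
have se0 : 0 <= s + eta by lra.
rewrite -[leRHS](ger0_norm se0) -sqrtr_sqr ler_wsqrtr//; nra.
Qed.

(** The hypothesis on [dp] says formally that the derivative of [sqrt p] is at most [g]; it survives
    the shift because [sqrt p] is at most the shifted root. *)
Lemma sqrt_shift_derive_le (R : realType) (p dp g eta : R) :
  0 <= p -> 0 < eta -> 0 <= g -> dp <= 2 * Num.sqrt p * g ->
  (2 * Num.sqrt (p + eta ^+ 2))^-1 * dp <= g.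
Proof.
move=> p0 eta0 g0 dpg.
have s0 : 0 < Num.sqrt (p + eta ^+ 2) by rewrite sqrtr_gt0 ltr_wpDl// exprn_gt0.
rewrite mulrC ler_pdivrMr ?mulr_gt0//; apply: le_trans dpg _.
rewrite mulrC ler_wpM2l// ler_wpM2l//; exact: sqrt_shift_ge.
Qed.

(** The shifted root minus [C * t] is non-increasing, and its initial value exceeds [sqrt (p 0)] by
    at most the arbitrary [eta]. *)
Lemma sqrt_linear_growth (R : realType) (p dp : R -> R) (C T : R) :
  0 <= C ->
  (forall t : R, 0 <= p t) ->
  (forall t : R, 0 <= t <= T -> is_derive t 1 p (dp t)) ->
  (forall t : R, 0 <= t <= T -> dp t <= 2 * Num.sqrt (p t) * C) ->
  forall t : R, 0 <= t <= T -> Num.sqrt (p t) <= Num.sqrt (p 0) + C * t.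
Proof.
move=> C0 p0 pdp dpC t tT; apply/ler_addgt0Pr => eta eta0.
pose f (s : R) : R := Num.sqrt (p s + eta ^+ 2) - C * s.
have fdf (s : R) : 0 <= s <= T ->
    is_derive s 1 f ((2 * Num.sqrt (p s + eta ^+ 2))^-1 * dp s - C).
  move=> sT; apply: is_deriveB; first exact: is_derive_sqrt_shift (pdp _ sT).
  by apply: is_derive_eq (is_deriveZ C (is_derive_id s 1)) _; rewrite [_ *: _]mulr1.
have : f t <= f 0.
  apply: (derive_le0_le fdf _ tT) => s sT; rewrite subr_le0.
  exact: sqrt_shift_derive_le (dpC _ sT).
rewrite /f mulr0 subr0; have := sqrt_shift_ge (p t) eta.
have := sqrt_shift_le (p0 0) eta0; lra.
Qed.

(* The square roots are not differentiable where p or q vanishes, whence the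
   regularisation by eta. *)
Lemma coupled_gronwall (R : realType) (p dp q dq : R -> R) (A B c kappa T : R) :
  0 <= A -> 0 <= B -> 0 <= c -> 1 <= kappa -> c <= kappa ->
  (forall t : R, 0 <= p t) -> (forall t : R, 0 <= q t) -> p 0 = 0 -> q 0 = 0 ->
  (forall t : R, 0 <= t <= T -> is_derive t 1 p (dp t)) ->
  (forall t : R, 0 <= t <= T -> is_derive t 1 q (dq t)) ->
  (forall t : R, 0 <= t <= T -> dp t <= 2 * Num.sqrt (p t) * Num.sqrt (q t)) ->
  (forall t : R, 0 <= t <= T ->
     dq t <= 2 * Num.sqrt (q t) * (c * Num.sqrt (p t) + A + B * t)) ->
  forall t : R, 0 <= t <= T ->
    Num.sqrt (p t) + Num.sqrt (q t) <= (A * t + B / 2 * t ^+ 2) * expR (t * kappa).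
Proof.
move=> A0 B0 c0 k1 ck p0 q0 pi qi pdp qdq dp_le dq_le t tT.
set E := expR (t * kappa); have E0 : 0 < E by exact: expR_gt0.
apply/ler_addgt0Pr => e e0.
(* The regularisation costs [2 * eta] at time 0, which the exponential amplifies to
   [2 * eta * E = e]. *)
pose eta : R := e / (2 * E); have eta0 : 0 < eta by rewrite divr_gt0// mulr_gt0.
pose P (s : R) : R := Num.sqrt (p s + eta ^+ 2).
pose Q (s : R) : R := Num.sqrt (q s + eta ^+ 2).
pose dP (s : R) : R := (2 * P s)^-1 * dp s; pose dQ s := (2 * Q s)^-1 * dq s.
pose ex (s : R) : R := expR (- kappa * s).
(* The sum [P + Q] times the integrating factor, minus the integral of the forcing [A + B * s]: this
   quantity is shown to be non-increasing. *)
pose f (s : R) : R := (P s + Q s) * ex s - (A * s + B / 2 * s ^+ 2).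
have dex (s : R) : is_derive s 1 ex (ex s * - kappa).
  apply: (@is_derive1_comp _ expR (fun s => - kappa * s)).
  by apply: is_derive_eq (is_deriveZ (- kappa) (is_derive_id s 1)) _;
    rewrite [_ *: _]mulr1.
have fdf (s : R) : 0 <= s <= T -> is_derive s 1 f
    ((P s + Q s) * (ex s * - kappa) + ex s * (dP s + dQ s) - (A + B * s)).
  move=> sT; apply: is_deriveB.
    apply: is_deriveM; apply: is_deriveD; apply: is_derive_sqrt_shift => //.
      exact: pdp.
    exact: qdq.
  apply: is_deriveD.
    by apply: is_derive_eq (is_deriveZ A (is_derive_id s 1)) _; rewrite [_ *: _]mulr1.
  apply: is_derive_eq (is_deriveZ (B / 2) (is_deriveX 2 (is_derive_id s 1))) _.
  by rewrite /GRing.scale/=; field.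
have : f t <= f 0.
  apply: (derive_le0_le fdf _ tT) => s sT; have /andP[s0 _] := sT.
  have dPQ : dP s <= Q s.
    apply: le_trans (sqrt_shift_ge _ eta).
    by apply: sqrt_shift_derive_le (dp_le _ sT) => //; exact: sqrtr_ge0.
  have dQP : dQ s <= c * P s + A + B * s.
    have Bs : 0 <= B * s by rewrite mulr_ge0.
    apply: (@le_trans _ _ (c * Num.sqrt (p s) + A + B * s)); last first.
      by rewrite !lerD2r ler_wpM2l//; exact: sqrt_shift_ge.
    apply: sqrt_shift_derive_le (dq_le _ sT) => //.
    by rewrite !addr_ge0// mulr_ge0// sqrtr_ge0.
  have ex0 : 0 < ex s by exact: expR_gt0.
  have ex1 : ex s <= 1 by rewrite -expR0 ler_expR mulNr oppr_le0 mulr_ge0//; lra.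
  have P0 : 0 <= P s by exact: sqrtr_ge0.
  have Q0 : 0 <= Q s by exact: sqrtr_ge0.
  have F0 : 0 <= A + B * s by rewrite addr_ge0// mulr_ge0.
  (* The first term collects the two differential inequalities against the rate [kappa]; the second
     is nonnegative before its sign, since the integrating factor is at most 1. *)
  have -> : (P s + Q s) * (ex s * - kappa) + ex s * (dP s + dQ s) - (A + B * s) =
    ex s * (dP s + dQ s - kappa * P s - kappa * Q s - (A + B * s))
    - (1 - ex s) * (A + B * s) by ring.
  rewrite subr_le0; apply: (@le_trans _ _ 0); last by rewrite mulr_ge0// subr_ge0.
  rewrite pmulr_rle0//.
  have : c * P s <= kappa * P s by rewrite ler_wpM2r.
  have : 1 * Q s <= kappa * Q s by rewrite ler_wpM2r.
  by rewrite mul1r; lra.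
have -> : f 0 = 2 * eta.
  rewrite /f /P /Q /ex pi qi !mulr0 expR0 expr0n/= mulr0 !add0r subr0 mulr1.
  by rewrite sqrtr_sqr gtr0_norm//; ring.
rewrite /f.
have exE : ex t = E^-1 by rewrite /ex /E mulNr expRN mulrC.
rewrite exE lerBlDr ler_pdivrMr// mulrDl.
have -> : 2 * eta * E = e by rewrite /eta; field; rewrite gt_eqF.
have := sqrt_shift_ge (p t) eta; have := sqrt_shift_ge (q t) eta.
rewrite /P /Q; lra.
Qed.

(** * Mean square spreads *)

(** Applied to the errors this is the square of [rms_error], kept without the root because it is
    differentiable in time. *)
Definition mean_sq {R : realType} {N n : nat} (u : 'I_N -> 'cV[R]_n) : R :=
  N%:R^-1 * \sum_(i < N) l2norm (u i) ^+ 2.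

Lemma mean_sq_eq0 (R : realType) (N n : nat) (u : 'I_N -> 'cV[R]_n) :
  (forall i, u i = 0) -> mean_sq u = 0.
Proof.
by move=> u0; rewrite /mean_sq big1 ?mulr0// => i _; rewrite u0 l2norm0 expr0n.
Qed.

Lemma mean_sq_ge0 (R : realType) (N n : nat) (u : 'I_N -> 'cV[R]_n) :
  0 <= mean_sq u.
Proof. by rewrite mulr_ge0// ?invr_ge0// sumr_ge0// => i _; rewrite sqr_ge0. Qed.

Lemma mean_sq_dist_ge0 (R : realType) (N n : nat) (u : 'I_N -> 'cV[R]_n) :
  0 <= mean_sq_dist u.
Proof.
rewrite mulr_ge0// ?invr_ge0// ?mulr_ge0//.
by apply: sumr_ge0 => i _; apply: sumr_ge0 => j _; rewrite sqr_ge0.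
Qed.

Lemma cauchy_schwarz_scaled (R : realType) (I : finType) (c : R) (f g : I -> R) :
  0 <= c -> c * (\sum_i f i * g i) <=
    Num.sqrt (c * \sum_i f i ^+ 2) * Num.sqrt (c * \sum_i g i ^+ 2).
Proof.
move=> c0; rewrite !sqrtrM// mulrACA -expr2 sqr_sqrtr//.
by rewrite ler_wpM2l//; exact: cauchy_schwarz.
Qed.

Lemma mean_sq_cauchy_schwarz (R : realType) (N n : nat) (u z : 'I_N -> 'cV[R]_n) :
  N%:R^-1 * (\sum_(i < N) \sum_(c < n) u i c 0 * z i c 0) <=
  Num.sqrt (mean_sq u) * Num.sqrt (mean_sq z).
Proof.
have msE (f : 'I_N -> 'cV[R]_n) : mean_sq f =
    N%:R^-1 * \sum_(p : 'I_N * 'I_n) f p.1 p.2 0 ^+ 2.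
  congr (_ * _); rewrite -(pair_bigA _ (fun i c => f i c 0 ^+ 2))/=.
  by apply: eq_bigr => i _; exact: sqr_l2norm.
rewrite !msE pair_bigA/=.
by apply: (cauchy_schwarz_scaled (fun p => u p.1 p.2 0)); rewrite invr_ge0.
Qed.

Lemma mean_sq_dist_cauchy_schwarz (R : realType) (N n : nat)
    (u z : 'I_N -> 'cV[R]_n) :
  (2 * N%:R ^+ 2)^-1 * (\sum_(i < N) \sum_(j < N) \sum_(c < n)
    (u i c 0 - u j c 0) * (z i c 0 - z j c 0)) <=
  Num.sqrt (mean_sq_dist u) * Num.sqrt (mean_sq_dist z).
Proof.
have msdE (f : 'I_N -> 'cV[R]_n) : mean_sq_dist f = (2 * N%:R ^+ 2)^-1 *
    \sum_(p : 'I_N * 'I_N * 'I_n) (f p.1.1 p.2 0 - f p.1.2 p.2 0) ^+ 2.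
  congr (_ * _); rewrite pair_bigA/=.
  rewrite -(pair_bigA _ (fun p c => (f p.1 c 0 - f p.2 c 0) ^+ 2))/=.
  apply: eq_bigr => p _; rewrite sqr_l2norm; apply: eq_bigr => c _.
  by rewrite !mxE.
rewrite !msdE !pair_bigA/=.
apply: (cauchy_schwarz_scaled (fun p : 'I_N * 'I_N * 'I_n =>
  u p.1.1 p.2 0 - u p.1.2 p.2 0)).
by rewrite invr_ge0 mulr_ge0// exprn_ge0.
Qed.

(* The terms with p = i and those with q = i of the double sum over (p, q)
   each add up to the left-hand side. *)
Lemma sum_sqr_dist_le (R : realType) (N n : nat) (u : 'I_N -> 'cV[R]_n) (i : 'I_N) :
  \sum_(j < N) l2norm (u i - u j) ^+ 2 <= N%:R ^+ 2 * mean_sq_dist u.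
Proof.
have N0 : N%:R != 0 :> R.
  by rewrite pnatr_eq0 -lt0n; case: (N) i => // -[].
have -> : N%:R ^+ 2 * mean_sq_dist u =
    2^-1 * \sum_(p < N) \sum_(q < N) l2norm (u p - u q) ^+ 2.
  by rewrite /mean_sq_dist; field; rewrite N0.
set S := \sum_j _.
suff : 2 * S <= \sum_(p < N) \sum_(q < N) l2norm (u p - u q) ^+ 2 by lra.
rewrite (bigD1 i)//= -/S mulr2n mulrDl mul1r lerD2l.
have -> : S = \sum_(p < N | p != i) l2norm (u i - u p) ^+ 2.
  by rewrite /S (bigD1 i)//= subrr l2norm0 expr0n add0r.
apply: ler_sum => p _; rewrite (bigD1 i)//= -opprB l2normN lerDl.
by apply: sumr_ge0 => q _; rewrite sqr_ge0.
Qed.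

Lemma enorm_dist_le (R : realType) (N n : nat) (u : 'I_N -> 'cV[R]_n) (i : 'I_N) :
  enorm (fun j => l2norm (u i - u j)) <= N%:R * Num.sqrt (mean_sq_dist u).
Proof.
have le0 : 0 <= N%:R :> R by [].
rewrite -[X in X * _](ger0_norm le0) -sqrtr_sqr -sqrtrM ?sqr_ge0//.
exact/ler_wsqrtr/sum_sqr_dist_le.
Qed.

(** Cauchy-Schwarz against the constant 1 gives [sqrt N], and the Euclidean norm of the distances
    gives [N] times the root spread; the mean cancels this [N]. *)
Lemma mean_dist_le (R : realType) (N n : nat) (u : 'I_N -> 'cV[R]_n) (i : 'I_N) :
  N%:R^-1 * (\sum_(j < N) l2norm (u i - u j)) <=
  Num.sqrt N%:R * Num.sqrt (mean_sq_dist u).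
Proof.
have N0 : 0 < N%:R :> R by rewrite ltr0n; case: (N) i => // -[].
have := cauchy_schwarz (fun _ : 'I_N => 1) (fun j => l2norm (u i - u j)).
under eq_bigr do rewrite mul1r.
rewrite enorm_cst// card_ord mulr1 => h.
rewrite ler_pdivrMl//; apply: le_trans h _; rewrite mulrCA ler_wpM2l//.
exact: enorm_dist_le.
Qed.

(** * Symmetrisation of alignment sums *)

(** Exchanging [i] and [j] reverses the sign. This is the source of momentum conservation. *)
Lemma sum_align_eq0 (R : realType) (N : nat) (b : 'I_N -> 'I_N -> R)
    (p : 'I_N -> R) : (forall i j, b i j = b j i) ->
  \sum_(i < N) \sum_(j < N) b i j * (p j - p i) = 0.
Proof.
move=> bC; set S := \sum_i _; suff : S = - S by lra.
rewrite {1}/S exchange_big/= -sumrN; apply: eq_bigr => j _.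
by rewrite -sumrN; apply: eq_bigr => i _; rewrite bC; ring.
Qed.

(** Adding the sum to its copy with [i] and [j] exchanged leaves minus the sum of
    [b i j * (p i - p j) ^+ 2]: alignment is dissipative. *)
Lemma sum_align_le0 (R : realType) (N : nat) (b : 'I_N -> 'I_N -> R)
    (p : 'I_N -> R) : (forall i j, b i j = b j i) -> (forall i j, 0 <= b i j) ->
  \sum_(i < N) p i * (\sum_(j < N) b i j * (p j - p i)) <= 0.
Proof.
move=> bC b0; set S := \sum_i _.
have SE : S = \sum_(i < N) \sum_(j < N) p i * (b i j * (p j - p i)).
  by apply: eq_bigr => i _; rewrite mulr_sumr.
suff : S + S <= 0 by lra.
rewrite {2}SE exchange_big/= SE -big_split/=; apply: sumr_le0 => i _.
rewrite -big_split/=; apply: sumr_le0 => j _.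
have -> : p i * (b i j * (p j - p i)) + p j * (b j i * (p i - p j)) =
  - (b i j * (p i - p j) ^+ 2) by rewrite (bC j); ring.
by rewrite oppr_le0 mulr_ge0// sqr_ge0.
Qed.

(** Polarised variance identity. It reduces sums over pairs to sums over single agents, up to a
    product that vanishes as soon as [p] or [q] has mean zero. *)
Lemma sum_pair_dist (R : realType) (N : nat) (p q : 'I_N -> R) :
  \sum_(i < N) \sum_(j < N) (p i - p j) * (q i - q j) =
  2 * N%:R * (\sum_(i < N) p i * q i) - 2 * (\sum_(i < N) p i) * (\sum_(i < N) q i).
Proof.
have sum_cst (x : R) : \sum_(j < N) x = N%:R * x.
  by rewrite sumr_const card_ord mulr_natl.
transitivity (\sum_(i < N) (N%:R * (p i * q i) + \sum_(j < N) p j * q j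
    - (p i * (\sum_(j < N) q j) + q i * (\sum_(j < N) p j)))).
  apply: eq_bigr => i _; rewrite !mulr_sumr -sum_cst -!big_split/= -sumrB.
  by apply: eq_bigr => j _; ring.
rewrite sumrB !big_split/= sum_cst -!mulr_suml -mulr_sumr; ring.
Qed.

(** * Time derivatives of sums and mean squares, coordinate by coordinate *)

Lemma is_derive_bigsum (R : realType) (I : finType) (h : I -> R -> R)
    (dh : I -> R) (t : R) : (forall i, is_derive t 1 (h i) (dh i)) ->
  is_derive t 1 (fun s => \sum_i h i s) (\sum_i dh i).
Proof.
move=> hdh; elim: (index_enum I) => [|i r IHr].
  have -> : (fun s => \sum_(i <- [::]) h i s) = cst 0 :> (R -> R).
    by apply/funext => s; rewrite big_nil.
  by rewrite big_nil; exact: is_derive_cst.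
have -> : (fun s => \sum_(j <- i :: r) h j s) =
    h i + (fun s => \sum_(j <- r) h j s) by apply/funext => s; rewrite big_cons.
by rewrite big_cons; apply: is_deriveD.
Qed.

Lemma is_derive_sqr (R : realType) (f : R -> R) (df t : R) :
  is_derive t 1 f df -> is_derive t 1 (fun s => f s ^+ 2) (2 * (f t * df)).
Proof.
move=> fdf; apply: is_derive_eq (is_deriveX 2 fdf) _.
by rewrite /GRing.scale/= expr1 mulrA.
Qed.

Lemma is_derive_scale (R : realType) (c : R) (f : R -> R) (df t : R) :
  is_derive t 1 f df -> is_derive t 1 (fun s => c * f s) (c * df).
Proof. exact: is_deriveZ. Qed.

Lemma is_derive_sub (R : realType) (f g : R -> R) (df dg t : R) :
  is_derive t 1 f df -> is_derive t 1 g dg ->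
  is_derive t 1 (fun s => f s - g s) (df - dg).
Proof. exact: is_deriveB. Qed.

Lemma is_derive_mean_sq (R : realType) (N n : nat) (u : R -> 'I_N -> 'cV[R]_n)
    (du : 'I_N -> 'cV[R]_n) (t : R) :
  (forall i c, is_derive t 1 (fun s => u s i c 0) (du i c 0)) ->
  is_derive t 1 (fun s => mean_sq (u s))
    (N%:R^-1 * (\sum_(i < N) \sum_(c < n) 2 * (u t i c 0 * du i c 0))).
Proof.
move=> hu; apply: is_derive_scale; apply: is_derive_bigsum => i.
under eq_fun do rewrite sqr_l2norm.
by apply: is_derive_bigsum => c; exact: is_derive_sqr.
Qed.

Lemma is_derive_mean_sq_dist (R : realType) (N n : nat)
    (u : R -> 'I_N -> 'cV[R]_n) (du : 'I_N -> 'cV[R]_n) (t : R) :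
  (forall i c, is_derive t 1 (fun s => u s i c 0) (du i c 0)) ->
  is_derive t 1 (fun s => mean_sq_dist (u s))
    ((2 * N%:R ^+ 2)^-1 * (\sum_(i < N) \sum_(j < N) \sum_(c < n)
      2 * ((u t i c 0 - u t j c 0) * (du i c 0 - du j c 0)))).
Proof.
move=> hu; apply: is_derive_scale.
apply: is_derive_bigsum => i; apply: is_derive_bigsum => j.
under eq_fun do rewrite sqr_l2norm.
apply: is_derive_bigsum => c; under eq_fun do rewrite !mxE.
by apply: is_derive_sqr; exact: is_derive_sub.
Qed.

(** * Cucker-Smale flows *)

Definition cs_force {R : realType} {N d : nat} (a : R -> R)
    (x v : 'I_N -> 'cV[R]_d) (i : 'I_N) : 'cV[R]_d :=
  N%:R^-1 *: \sum_(j < N) a (l2norm (x i - x j)) *: (v j - v i).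

(** The system with two-sided scalar derivatives also at time 0, the form to which the differential
    inequalities above apply. *)
Definition cs_flow {R : realType} {N d : nat} (a : R -> R)
    (x v : R -> 'I_N -> 'cV[R]_d) : Prop :=
  forall (t : R) (i : 'I_N) (c : 'I_d), 0 <= t ->
    is_derive t 1 (fun s => x s i c 0) (v t i c 0) /\
    is_derive t 1 (fun s => v s i c 0) (cs_force a (x t) (v t) i c 0).

(** Each component is continued affinely to negative times with its slope at 0. The force at a
    nonnegative time sees only the state at that time, so the system still holds there. *)
Lemma cs_flow_extension (R : realType) (N d : nat) (a : R -> R)
    (x v : R -> 'I_N -> 'cV[R]_d) : cucker_smale_solution a x v ->
  exists x' v' : R -> 'I_N -> 'cV[R]_d, cs_flow a x' v' /\
    forall t : R, 0 <= t -> x' t = x t /\ v' t = v t.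
Proof.
move=> sol.
pose ext (u du : R -> 'I_N -> 'cV[R]_d) (s : R) : 'I_N -> 'cV[R]_d :=
  if 0 <= s then u s else fun i => u 0 i + s *: du 0 i.
have extE u du (t : R) : 0 <= t -> ext u du t = u t by rewrite /ext => ->.
have ext_derive u du i c (t : R) : 0 <= t ->
    (forall s : R, 0 <= s ->
      has_derivative_within `[0, +oo[ (fun s => u s i) s (du s i)) ->
    is_derive t 1 (fun s => ext u du s i c 0) (du t i c 0).
  move=> t0 udu.
  have -> : (fun s => ext u du s i c 0) =
      (fun s => if 0 <= s then u s i c 0 else u 0 i c 0 + s * du 0 i c 0).
    by apply/funext => s; rewrite /ext; case: ifP => // _; rewrite !mxE.
  apply: (is_derive_extend (f := fun s => u s i c 0) (df := fun s => du s i c 0)) => //.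
  by move=> s s0; apply: has_derivative_within_coord; exact: udu.
pose F t := cs_force a (x t) (v t).
exists (ext x v), (ext v F); split; last by move=> t t0; rewrite !extE.
move=> t i c t0; rewrite !extE//; split.
  by apply: ext_derive => // s s0; have [] := sol s i s0.
by apply: (ext_derive v F) => // s s0; have [] := sol s i s0.
Qed.

Lemma cs_forceE (R : realType) (N d : nat) (a : R -> R)
    (x v : 'I_N -> 'cV[R]_d) (i : 'I_N) (c : 'I_d) :
  cs_force a x v i c 0 =
  N%:R^-1 * \sum_(j < N) a (l2norm (x i - x j)) * (v j c 0 - v i c 0).
Proof.
by rewrite mxE summxE; congr (_ * _); apply: eq_bigr => j _; rewrite !mxE.
Qed.

Lemma sum_cs_force (R : realType) (N d : nat) (a : R -> R)
    (x v : 'I_N -> 'cV[R]_d) (c : 'I_d) :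
  \sum_(i < N) cs_force a x v i c 0 = 0.
Proof.
under eq_bigr do rewrite cs_forceE.
rewrite -mulr_sumr (sum_align_eq0 (b := fun i j => a (l2norm (x i - x j)))) ?mulr0//.
by move=> i j; rewrite l2norm_distC.
Qed.

Lemma cs_sum_velocity (R : realType) (N d : nat) (a : R -> R)
    (x v : R -> 'I_N -> 'cV[R]_d) : cs_flow a x v ->
  forall t : R, 0 <= t -> \sum_(i < N) v t i = \sum_(i < N) v 0 i.
Proof.
move=> flow t t0; apply/matrixP => c c'; rewrite ord1 !summxE.
have dsum (s : R) : 0 <= s <= t ->
    is_derive s 1 (fun s => \sum_(i < N) v s i c 0) 0.
  move=> /andP[s0 _]; apply: is_derive_eq (sum_cs_force a (x s) (v s) c).
  by apply: is_derive_bigsum => i; have [] := flow s i c s0.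
have tt : 0 <= t <= t by rewrite t0/=.
(* A function with zero derivative and its negative are both non-increasing, which gives the two
   inequalities. *)
apply/eqP; rewrite eq_le (derive_le0_le dsum _ tt)//=.
rewrite -lerN2.
apply: (derive_le0_le (f := fun s => - \sum_(i < N) v s i c 0) (df := fun=> 0) _ _ tt) => //.
by move=> s st; apply: is_derive_eq (is_deriveN (dsum s st)) (oppr0 _).
Qed.

(** The derivative is a sum over pairs of velocity differences times force differences; it reduces
    to velocity against force, which symmetrisation shows to be nonpositive. *)
Lemma cs_velocity_spread (R : realType) (N d : nat) (a : R -> R)
    (x v : R -> 'I_N -> 'cV[R]_d) : (forall r, 0 <= r -> 0 < a r) ->
  cs_flow a x v ->
  forall t : R, 0 <= t -> mean_sq_dist (v t) <= mean_sq_dist (v 0).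
Proof.
move=> a0 flow t t0; have tt : 0 <= t <= t by rewrite t0/=.
apply: (derive_le0_le (f := fun s => mean_sq_dist (v s)) _ _ tt).
  move=> s /andP[s0 _]; apply: is_derive_mean_sq_dist => i c.
  by have [_] := flow s i c s0; exact.
move=> s _ /=; apply: mulr_ge0_le0; first by rewrite invr_ge0 mulr_ge0// exprn_ge0.
under eq_bigr do rewrite exchange_big/=.
rewrite exchange_big/=; apply: sumr_le0 => c _.
under eq_bigr do rewrite -mulr_sumr.
(* The forces add up to zero, so the product of the two sums drops out. *)
rewrite -mulr_sumr sum_pair_dist sum_cs_force mulr0 subr0.
rewrite pmulr_rle0// mulr_ge0_le0//.
under eq_bigr do rewrite cs_forceE mulrCA.
rewrite -mulr_sumr mulr_ge0_le0// ?invr_ge0//.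
apply: (sum_align_le0 (b := fun i j => a (l2norm (x s i - x s j)))) => i j.
  by rewrite l2norm_distC.
by rewrite ltW// a0// l2norm_ge0.
Qed.

(** By Cauchy-Schwarz the derivative of the position spread [X] is at most [2 sqrt X sqrt V], and
    the velocity spread [V] never exceeds its initial value. *)
Lemma cs_position_spread (R : realType) (N d : nat) (a : R -> R)
    (x v : R -> 'I_N -> 'cV[R]_d) : (forall r, 0 <= r -> 0 < a r) ->
  cs_flow a x v ->
  forall t : R, 0 <= t -> Num.sqrt (mean_sq_dist (x t)) <=
    Num.sqrt (mean_sq_dist (x 0)) + Num.sqrt (mean_sq_dist (v 0)) * t.
Proof.
move=> a0 flow t t0; have tt : 0 <= t <= t by rewrite t0/=.
apply: (sqrt_linear_growth (p := fun s => mean_sq_dist (x s)) _ _ _ _ tt).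
- exact: sqrtr_ge0.
- by move=> s; exact: mean_sq_dist_ge0.
- move=> s /andP[s0 _]; apply: is_derive_mean_sq_dist => i c.
  by have [+ _] := flow s i c s0; exact.
move=> s /andP[s0 _] /=.
under eq_bigr do under eq_bigr do rewrite -mulr_sumr.
under eq_bigr do rewrite -mulr_sumr.
rewrite -mulr_sumr mulrCA -mulrA ler_wpM2l//.
apply: le_trans (mean_sq_dist_cauchy_schwarz _ _) _.
rewrite ler_wpM2l ?sqrtr_ge0//; apply: ler_wsqrtr.
exact: (cs_velocity_spread a0 flow).
Qed.

(** * Error between the projected flow and the low-dimensional flow *)

(** The first alternative bounds the gap by [eps * l2norm x]; in the second both norms lie between 0
    and [delta]. The sum covers both cases. *)
Lemma weak_JL_gap (R : realType) (k d : nat) (eps delta : R)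
    (M : 'M[R]_(k, d)) (x : 'cV[R]_d) : 0 <= eps -> 0 <= delta ->
  weak_JL eps delta M x ->
  `|l2norm (M *m x) - l2norm x| <= eps * l2norm x + delta.
Proof.
rewrite /weak_JL => eps0 delta0; have := l2norm_ge0 x; have := l2norm_ge0 (M *m x).
set p := l2norm _; set q := l2norm _ => p0 q0; have eq0 := mulr_ge0 eps0 q0.
by rewrite ler_norml; case=> [/andP[h1 h2]|[h1 h2]]; apply/andP; split; lra.
Qed.

(** The normalisation of [mean_sq_dist] by [2 N^2] is where the 2 under the roots in [K1] and [K3]
    comes from. *)
Lemma sum_dist_enorm (R : realType) (N d : nat) (x : 'I_N -> 'cV[R]_d) :
  enorm (fun i => enorm (fun j => l2norm (x i - x j))) =
  N%:R * Num.sqrt (2 * mean_sq_dist x).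
Proof.
have [N0|N0] := posnP N.
  by subst N; rewrite /enorm big_ord0 sqrtr0 mul0r.
have NR0 : N%:R != 0 :> R by rewrite pnatr_eq0 -lt0n.
have le0 : 0 <= N%:R :> R by [].
rewrite -[X in X * _](ger0_norm le0) -sqrtr_sqr -sqrtrM ?sqr_ge0//.
congr Num.sqrt; under eq_bigr do rewrite sqr_enorm.
by rewrite /mean_sq_dist; field.
Qed.

Lemma enorm_mean_sq (R : realType) (N d : nat) (u : 'I_N -> 'cV[R]_d) :
  enorm (fun i => l2norm (u i)) = Num.sqrt N%:R * Num.sqrt (mean_sq u).
Proof.
have [N0|N0] := posnP N.
  by subst N; rewrite /enorm big_ord0 sqrtr0 mul0r.
have NR0 : N%:R != 0 :> R by rewrite pnatr_eq0 -lt0n.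
by rewrite -sqrtrM// /mean_sq mulrA mulfV// mul1r.
Qed.

(** The Lipschitz bound gives a pointwise estimate by four terms, to which Minkowski's inequality
    over the [N^2] pairs is applied. *)
Lemma kernel_gap_le (R : realType) (N k d : nat) (a : R -> R) (La eps delta : R)
    (M : 'M[R]_(k, d)) (x : 'I_N -> 'cV[R]_d) (y : 'I_N -> 'cV[R]_k) :
  0 <= La -> 0 <= eps -> 0 <= delta ->
  (forall r s, 0 <= r -> 0 <= s -> `|a r - a s| <= La * `|r - s|) ->
  (forall i j, weak_JL eps delta M (x i - x j)) ->
  enorm (fun i => enorm (fun j =>
    `|a (l2norm (y i - y j)) - a (l2norm (x i - x j))|)) <=
  N%:R * (La * (2 * Num.sqrt (mean_sq (fun i => y i - M *m x i)) +
     eps * Num.sqrt (2 * mean_sq_dist x) + delta)).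
Proof.
move=> La0 eps0 delta0 a_lip JL; pose r i := y i - M *m x i.
rewrite -enorm_pair/=.
pose I := ('I_N * 'I_N)%type.
pose g (p : I) := l2norm (r p.1) + l2norm (r p.2) +
  eps * l2norm (x p.1 - x p.2) + delta.
apply: (@le_trans _ _ (enorm (fun p : I => La * g p))).
  apply: ler_enorm => -[i j]; rewrite normr_id/=.
  apply: le_trans (a_lip _ _ (l2norm_ge0 _) (l2norm_ge0 _)) _.
  rewrite ler_wpM2l// /g/=.
  (* The norm of [M (x_i - x_j)] is inserted between the two distances: one gap comes from the
     errors, the other from the projection. *)
  have := weak_JL_gap eps0 delta0 (JL i j); rewrite mulmxBr.
  have := ler_l2norm_dist (y i - y j) (M *m x i - M *m x j).
  have -> : y i - y j - (M *m x i - M *m x j) = r i + - r j.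
    by rewrite /r !opprB addrACA [RHS]addrACA [- y j + _]addrC.
  have := ler_l2normD (r i) (- r j); rewrite l2normN.
  by rewrite !ler_norml => ? /andP[? ?] /andP[? ?]; apply/andP; split; lra.
rewrite enormZ// mulrCA ler_wpM2l//.
have sN : Num.sqrt N%:R * Num.sqrt N%:R = N%:R :> R by rewrite -expr2 sqr_sqrtr.
have g1 : enorm (fun p : I => l2norm (r p.1)) = N%:R * Num.sqrt (mean_sq r).
  rewrite (enorm_pair (fun i _ => l2norm (r i))).
  have -> : (fun i => enorm (fun _ : 'I_N => l2norm (r i))) =
      (fun i => Num.sqrt N%:R * l2norm (r i)).
    by apply/funext => i; rewrite enorm_cst ?card_ord// l2norm_ge0.
  by rewrite enormZ ?sqrtr_ge0// enorm_mean_sq mulrA sN.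
have g2 : enorm (fun p : I => l2norm (r p.2)) = N%:R * Num.sqrt (mean_sq r).
  rewrite (enorm_pair (fun _ j => l2norm (r j))) enorm_cst ?enorm_ge0//.
  by rewrite card_ord enorm_mean_sq mulrA sN.
have g3 : enorm (fun p : I => eps * l2norm (x p.1 - x p.2)) =
    N%:R * (eps * Num.sqrt (2 * mean_sq_dist x)).
  rewrite enormZ// (enorm_pair (fun i j => l2norm (x i - x j))).
  by rewrite sum_dist_enorm mulrCA.
have g4 : enorm (fun p : I => delta) = N%:R * delta.
  by rewrite enorm_cst// card_prod card_ord natrM sqrtrM// sN.
have h1 := ler_enormD (fun p : I => l2norm (r p.1) + l2norm (r p.2) +
  eps * l2norm (x p.1 - x p.2)) (fun=> delta).
have h2 := ler_enormD (fun p : I => l2norm (r p.1) + l2norm (r p.2))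
  (fun p : I => eps * l2norm (x p.1 - x p.2)).
have h3 := ler_enormD (fun p : I => l2norm (r p.1)) (fun p : I => l2norm (r p.2)).
by rewrite g4 in h1; rewrite g3 in h2; rewrite g1 g2 in h3; rewrite /g; lra.
Qed.

(** This is half the derivative of the mean square velocity error. The kernel gap is attached to
    [w], whose spread is controlled by its initial value; the rest aligns the errors themselves and
    contributes a nonpositive amount. *)
Lemma error_force_le (R : realType) (N k d : nat) (a : R -> R) (La eps delta : R)
    (M : 'M[R]_(k, d)) (x v : 'I_N -> 'cV[R]_d) (y w : 'I_N -> 'cV[R]_k) :
  (0 < N)%N ->
  0 <= La -> 0 <= eps -> 0 <= delta ->
  (forall r, 0 <= r -> 0 < a r) ->
  (forall r s, 0 <= r -> 0 <= s -> `|a r - a s| <= La * `|r - s|) ->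
  (forall i j, weak_JL eps delta M (x i - x j)) ->
  N%:R^-1 * (\sum_(i < N) \sum_(c < k) (w i - M *m v i) c 0 *
    (cs_force a y w i - M *m cs_force a x v i) c 0) <=
  Num.sqrt (mean_sq (fun i => w i - M *m v i)) *
    (La * Num.sqrt (N%:R * mean_sq_dist w) *
      (2 * Num.sqrt (mean_sq (fun i => y i - M *m x i)) +
       eps * Num.sqrt (2 * mean_sq_dist x) + delta)).
Proof.
move=> N0 La0 eps0 delta0 a0 a_lip JL; pose s i := w i - M *m v i.
have NR0 : 0 < N%:R :> R by rewrite ltr0n.
pose ax i j := a (l2norm (x i - x j)); pose ay i j := a (l2norm (y i - y j)).
have forceE i c : (cs_force a y w i - M *m cs_force a x v i) c 0 = N%:R^-1 *
    (\sum_(j < N) (ay i j - ax i j) * (w j c 0 - w i c 0)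
     + \sum_(j < N) ax i j * (s j c 0 - s i c 0)).
  rewrite /cs_force -scalemxAr -scalerBr mulmx_sumr -sumrB mxE; congr (_ * _).
  rewrite summxE -big_split/=; apply: eq_bigr => j _.
  rewrite -scalemxAr mulmxBr /s !mxE -/(ax i j) -/(ay i j); ring.
have -> : \sum_(i < N) \sum_(c < k) s i c 0 *
      (cs_force a y w i - M *m cs_force a x v i) c 0 = N%:R^-1 *
    (\sum_(i < N) \sum_(j < N) (ay i j - ax i j) *
       (\sum_(c < k) s i c 0 * (w j c 0 - w i c 0))
     + \sum_(c < k) \sum_(i < N) s i c 0 *
       (\sum_(j < N) ax i j * (s j c 0 - s i c 0))).
  rewrite [X in _ = _ * (_ + X)]exchange_big/= -big_split/= mulr_sumr.
  apply: eq_bigr => i _.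
  under [X in _ = _ * (X + _)]eq_bigr do rewrite mulr_sumr.
  rewrite [X in _ = _ * (X + _)]exchange_big/= -big_split/= mulr_sumr.
  apply: eq_bigr => c _; rewrite forceE mulrCA mulrDr !mulr_sumr.
  by congr (_ * (_ + _)); apply: eq_bigr => j _; rewrite mulrCA.
have align_le0 : \sum_(c < k) \sum_(i < N) s i c 0 *
    (\sum_(j < N) ax i j * (s j c 0 - s i c 0)) <= 0.
  apply: sumr_le0 => c _; apply: sum_align_le0 => i j.
    by rewrite /ax l2norm_distC.
  by rewrite ltW// a0// l2norm_ge0.
have mixed_le : \sum_(i < N) \sum_(j < N) (ay i j - ax i j) *
      (\sum_(c < k) s i c 0 * (w j c 0 - w i c 0)) <=
    enorm (fun i => enorm (fun j => `|ay i j - ax i j|)) *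
    enorm (fun i => enorm (fun j => l2norm (s i) * l2norm (w i - w j))).
  rewrite -!enorm_pair/=.
  apply: le_trans (cauchy_schwarz (fun p : 'I_N * 'I_N => `|ay p.1 p.2 - ax p.1 p.2|) _).
  rewrite pair_bigA/=; apply: ler_sum => -[i j] _ /=.
  apply: le_trans (ler_norm _) _; rewrite normrM ler_wpM2l//.
  rewrite l2norm_distC.
  have -> : \sum_(c < k) s i c 0 * (w j c 0 - w i c 0) =
      \sum_(c < k) s i c 0 * (w j - w i) c 0.
    by apply: eq_bigr => c _; congr (_ * _); rewrite !mxE.
  exact: (cauchy_schwarz_abs (fun c => s i c 0)).
(* For each fixed [i] the norm over [j] is at most [N sqrt W]; summing over [i] then produces the
   factor [sqrt (N W)]. *)
have sw_le : enorm (fun i => enorm (fun j => l2norm (s i) * l2norm (w i - w j))) <=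
    N%:R * Num.sqrt (N%:R * mean_sq_dist w) * Num.sqrt (mean_sq s).
  have -> : N%:R * Num.sqrt (N%:R * mean_sq_dist w) * Num.sqrt (mean_sq s) =
      enorm (fun i => N%:R * Num.sqrt (mean_sq_dist w) * l2norm (s i)).
    rewrite enormZ ?mulr_ge0 ?sqrtr_ge0// enorm_mean_sq sqrtrM//; ring.
  apply: ler_enorm => i; rewrite ger0_norm ?enorm_ge0// enormZ ?l2norm_ge0//.
  by rewrite mulrC ler_wpM2r ?l2norm_ge0//; exact: enorm_dist_le.
have gap := kernel_gap_le y La0 eps0 delta0 a_lip JL.
(* The two factors [1 / N], from the mean and from the force, are matched by one factor [N] in each
   of [gap] and [sw_le]. *)
rewrite mulrA -invfM ler_pdivrMl ?mulr_gt0//.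
apply: le_trans (_ : _ <= enorm (fun i => enorm (fun j => `|ay i j - ax i j|)) *
    enorm (fun i => enorm (fun j => l2norm (s i) * l2norm (w i - w j)))) _.
  by rewrite -[leRHS]addr0; exact: lerD.
apply: le_trans (ler_pM (enorm_ge0 _) (enorm_ge0 _) gap sw_le) _.
by rewrite le_eqVlt; apply/orP; left; apply/eqP; ring.
Qed.

Lemma max_error_le (R : realType) (N k d : nat) (M : 'M[R]_(k, d))
    (y : 'I_N -> 'cV[R]_k) (x : 'I_N -> 'cV[R]_d) :
  max_error M y x <= Num.sqrt N%:R * rms_error M y x.
Proof.
rewrite -[_ * _](enorm_mean_sq (fun i => y i - M *m x i)).
apply: bigmax_le => [|i _]; first exact: enorm_ge0.
rewrite -[leLHS](ger0_norm (l2norm_ge0 _)).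
exact: (ler_enorm_coord (fun i => l2norm (y i - M *m x i))).
Qed.

(** As the errors sum to zero, each one is the average over [j] of [(w_i - w_j) - M (v_i - v_j)], so
    mean distances within [v] and [w] bound it. *)
Lemma max_error_spread_le (R : realType) (N k d : nat) (M : 'M[R]_(k, d))
    (w : 'I_N -> 'cV[R]_k) (v : 'I_N -> 'cV[R]_d) :
  \sum_(i < N) (w i - M *m v i) = 0 ->
  max_error M w v <= Num.sqrt N%:R *
    (l2_opnorm M * Num.sqrt (mean_sq_dist v) + Num.sqrt (mean_sq_dist w)).
Proof.
move=> sum0.
have opM0 := l2_opnorm_ge0 M.
apply: bigmax_le => [|i _].
  by rewrite mulr_ge0 ?sqrtr_ge0// addr_ge0 ?mulr_ge0 ?sqrtr_ge0.
have NR0 : 0 < N%:R :> R by rewrite ltr0n; case: (N) i => // -[].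
have -> : proj_error M w v i = N%:R^-1 *
    l2norm (\sum_(j < N) ((w i - w j) - M *m (v i - v j))).
  have -> : \sum_(j < N) ((w i - w j) - M *m (v i - v j)) =
      N%:R *: (w i - M *m v i).
    transitivity (\sum_(j < N) (w i - M *m v i) - \sum_(j < N) (w j - M *m v j)).
      rewrite -sumrB; apply: eq_bigr => j _.
      by rewrite mulmxBr !opprB addrACA [RHS]addrACA [- w j + _]addrC.
    by rewrite sum0 subr0 sumr_const card_ord scaler_nat.
  by rewrite l2normZ ger0_norm// mulKf// gt_eqF.
have vi := mean_dist_le v i; have wi := mean_dist_le w i.
apply: (@le_trans _ _ (N%:R^-1 * \sum_(j < N)
    (l2norm (w i - w j) + l2_opnorm M * l2norm (v i - v j)))).
  rewrite ler_wpM2l ?invr_ge0//; apply: le_trans (ler_l2norm_sum _) _.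
  apply: ler_sum => j _; apply: le_trans (ler_l2normD _ _) _.
  by rewrite l2normN lerD2l; exact: l2_opnormP.
rewrite big_split/= -mulr_sumr mulrDr mulrCA.
have := ler_wpM2l opM0 vi; lra.
Qed.

Lemma is_derive_projection_gap (R : realType) (k d : nat) (M : 'M[R]_(k, d))
    (x : R -> 'cV[R]_d) (dx : 'cV[R]_d) (y : R -> 'cV[R]_k) (dy : 'cV[R]_k)
    (t : R) (c : 'I_k) :
  (forall l, is_derive t 1 (fun s => x s l 0) (dx l 0)) ->
  is_derive t 1 (fun s => y s c 0) (dy c 0) ->
  is_derive t 1 (fun s => (y s - M *m x s) c 0) ((dy - M *m dx) c 0).
Proof.
move=> xdx ydy.
have subE (z : 'cV[R]_k) (u : 'cV[R]_d) :
    (z - M *m u) c 0 = z c 0 - \sum_(l < d) M c l * u l 0 by rewrite !mxE.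
under eq_fun do rewrite subE; rewrite subE.
apply: is_derive_sub => //.
by apply: is_derive_bigsum => l; exact: is_derive_scale.
Qed.

(** Gronwall for the mean squares of the position and velocity errors, with coupling [2 * L];
    [kappa] stands for any rate dominating 1 and this coupling. *)
Lemma cs_flow_error (R : realType) (N k d : nat) (a : R -> R)
    (La eps delta kappa T : R) (M : 'M[R]_(k, d))
    (x v : R -> 'I_N -> 'cV[R]_d) (y w : R -> 'I_N -> 'cV[R]_k) :
  (0 < N)%N -> 0 <= La -> 0 <= eps -> 0 <= delta ->
  (forall r, 0 <= r -> 0 < a r) ->
  (forall r s, 0 <= r -> 0 <= s -> `|a r - a s| <= La * `|r - s|) ->
  cs_flow a x v -> cs_flow a y w ->
  (forall i, y 0 i = M *m x 0 i) -> (forall i, w 0 i = M *m v 0 i) ->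
  (forall t : R, 0 <= t <= T ->
    forall i j, weak_JL eps delta M (x t i - x t j)) ->
  let L := La * Num.sqrt (N%:R * mean_sq_dist (w 0)) in
  1 <= kappa -> 2 * L <= kappa ->
  forall t : R, 0 <= t <= T ->
    rms_error M (y t) (x t) + rms_error M (w t) (v t) <=
    (L * (eps * Num.sqrt (2 * mean_sq_dist (x 0)) + delta) * t +
     L * (eps * Num.sqrt (2 * mean_sq_dist (v 0))) / 2 * t ^+ 2)
    * expR (t * kappa).
Proof.
move=> N0 La0 eps0 delta0 a0 a_lip xv yw y_init w_init JL L kappa1 kappaL t tT.
have L0 : 0 <= L by rewrite mulr_ge0 ?sqrtr_ge0.
pose r (s : R) i := y s i - M *m x s i; pose e (s : R) i := w s i - M *m v s i.
have dr (s : R) i c : 0 <= s -> is_derive s 1 (fun s => r s i c 0) (e s i c 0).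
  move=> s0; apply: (@is_derive_projection_gap _ _ _ M (x ^~ i) _ (y ^~ i)) => [l|].
    by have [] := xv s i l s0.
  by have [] := yw s i c s0.
have de (s : R) i c : 0 <= s -> is_derive s 1 (fun s => e s i c 0)
    ((cs_force a (y s) (w s) i - M *m cs_force a (x s) (v s) i) c 0).
  move=> s0; apply: (@is_derive_projection_gap _ _ _ M (v ^~ i) _ (w ^~ i)) => [l|].
    by have [] := xv s i l s0.
  by have [] := yw s i c s0.
apply: (coupled_gronwall (p := fun s => mean_sq (r s)) (q := fun s => mean_sq (e s))
  (c := 2 * L) _ _ _ kappa1 kappaL _ _ _ _ _ _ _ _ tT) => //.
- by rewrite mulr_ge0// addr_ge0// mulr_ge0// sqrtr_ge0.
- by rewrite mulr_ge0// mulr_ge0// sqrtr_ge0.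
- by rewrite mulr_ge0.
- by move=> s; exact: mean_sq_ge0.
- by move=> s; exact: mean_sq_ge0.
- by apply: mean_sq_eq0 => i; rewrite /r y_init subrr.
- by apply: mean_sq_eq0 => i; rewrite /e w_init subrr.
- by move=> s /andP[s0 _]; apply: is_derive_mean_sq => i c; exact: dr.
- by move=> s /andP[s0 _]; apply: is_derive_mean_sq => i c; exact: de.
- move=> s _ /=; under eq_bigr do rewrite -mulr_sumr.
  rewrite -mulr_sumr mulrCA -mulrA ler_wpM2l//.
  exact: mean_sq_cauchy_schwarz.
move=> s sT /=; have /andP[s0 _] := sT.
under eq_bigr do rewrite -mulr_sumr.
rewrite -mulr_sumr mulrCA -mulrA ler_wpM2l//.
apply: le_trans (error_force_le (v s) (y s) (w s) N0 La0 eps0 delta0 a0 a_lip (JL s sT)) _.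
rewrite ler_wpM2l ?sqrtr_ge0// -/(r s).
(* Linear growth of the position spread makes the forcing affine in time, whence the quadratic term
   of the bound. *)
have spread : Num.sqrt (2 * mean_sq_dist (x s)) <=
    Num.sqrt (2 * mean_sq_dist (x 0)) + Num.sqrt (2 * mean_sq_dist (v 0)) * s.
  rewrite !(sqrtrM _ (ler0n R 2)) -mulrA -mulrDr ler_wpM2l ?sqrtr_ge0//.
  exact: cs_position_spread a0 xv s s0.
have WL : La * Num.sqrt (N%:R * mean_sq_dist (w s)) <= L.
  rewrite ler_wpM2l// ler_wsqrtr// ler_wpM2l//.
  exact: cs_velocity_spread a0 yw s s0.
have := ler_wpM2l eps0 spread => spread_eps.
set p := Num.sqrt (mean_sq (r s)).
have p0 : 0 <= p by exact: sqrtr_ge0.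
apply: le_trans (ler_wpM2r _ WL) _.
  by rewrite !addr_ge0// mulr_ge0// sqrtr_ge0.
apply: (@le_trans _ _ (L * (2 * p + eps * (Num.sqrt (2 * mean_sq_dist (x 0)) +
    Num.sqrt (2 * mean_sq_dist (v 0)) * s) + delta))).
  by rewrite ler_wpM2l// lerD2r lerD2l.
by rewrite le_eqVlt; apply/orP; left; apply/eqP; ring.
Qed.

Theorem theorem3p2 (R : realType) (N d k : nat)
    (N_gt0 : (0 < N)%N) (k_gt0 : (0 < k)%N) (le_k_d : (k <= d)%N)
    (T : R) (T_gt0 : 0 < T)
    (a : R -> R) (La : R)
    (a_gt0 : forall r, 0 <= r -> 0 < a r)
    (a_noninc : {in `[0, +oo[ &, {homo a : r s / r <= s >-> s <= r}})
    (a_lip : La.-lipschitz_(`[0, +oo[) a)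
    (delta eps : R) (delta_gt0 : 0 < delta) (eps_gt0 : 0 < eps)
    (eps_lt1 : eps < 1)
    (M : 'M[R]_(k, d))
    (x v : R -> 'I_N -> 'cV[R]_d) (y w : R -> 'I_N -> 'cV[R]_k)
    (xv_sol : cucker_smale_solution a x v)
    (yw_sol : cucker_smale_solution a y w)
    (y_init : forall i, y 0 i = M *m x 0 i)
    (w_init : forall i, w 0 i = M *m v 0 i)
    (M_JL : forall t, 0 <= t <= T ->
       forall i j, weak_JL eps delta M (x t i - x t j)) :
  let X := fun t => mean_sq_dist (x t) in
  let V := fun t => mean_sq_dist (v t) in
  let W := fun t => mean_sq_dist (w t) in
  let Ex := fun t => max_error M (y t) (x t) in
  let Ev := fun t => max_error M (w t) (v t) in
  let E2x := fun t => rms_error M (y t) (x t) in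
  let E2v := fun t => rms_error M (w t) (v t) in
  let K1 := La * Num.sqrt (N%:R * W 0) * Num.sqrt (2 * X 0) in
  let K2 := 2 * La * Num.sqrt (N%:R * W 0) in
  let K3 := 2^-1 * La * Num.sqrt (N%:R * W 0) * Num.sqrt (2 * V 0) in
  let K := mx22 (2 * a 0) (2 * La * Num.sqrt (N%:R * W 0)) 1 0 in
  let B := fun t => ((eps * K1 + delta * K2) * t + eps * K3 * t ^+ 2)
                    * expR (t * l1_opnorm K) in
  forall t, 0 <= t <= T ->
    [/\ Ex t + Ev t <= Num.sqrt N%:R * B t,
        E2x t + E2v t <= B t
      & Ev t <= Num.sqrt N%:R *
          Num.min (B t) (l2_opnorm M * Num.sqrt (V t) + Num.sqrt (W t))].

Proof.
move=> X V W Ex Ev E2x E2v K1 K2 K3 K B t tT.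
have /andP[t0 _] := tT.
have a_lip' r s : 0 <= r -> 0 <= s -> `|a r - a s| <= La * `|r - s|.
  by move=> r0 s0; apply: (a_lip (r, s)); split; rewrite /= in_itv/= ?r0 ?s0.
(* The Lipschitz inequality between the points 1 and 0 bounds a nonnegative number by [La]. *)
have La0 : 0 <= La.
  by have := a_lip' 1 0 ler01 (lexx 0); rewrite subr0 normr1 mulr1; apply: le_trans.
have [x' [v' [xv_flow xvE]]] := cs_flow_extension xv_sol.
have [y' [w' [yw_flow ywE]]] := cs_flow_extension yw_sol.
have [x0E v0E] := xvE 0 (lexx 0); have [y0E w0E] := ywE 0 (lexx 0).
have [xtE vtE] := xvE t t0; have [ytE wtE] := ywE t t0.
have rms_le : E2x t + E2v t <= B t.
  have c0 : 0 <= 2 * La * Num.sqrt (N%:R * W 0).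
    by rewrite !mulr_ge0// sqrtr_ge0.
  have [kappa1 kappaL] := l1_opnorm_mx22 (mulr_ge0 (ler0n R 2) (ltW (a_gt0 _ (lexx 0)))) c0.
  have := @cs_flow_error R N k d a La eps delta (l1_opnorm K) T M x' v' y' w'
    N_gt0 La0 (ltW eps_gt0) (ltW delta_gt0) a_gt0 a_lip' xv_flow yw_flow.
  rewrite x0E v0E y0E w0E => /(_ y_init w_init) => error_le.
  have {}error_le := error_le _ kappa1 _ t tT.
  rewrite xtE vtE ytE wtE in error_le; apply: le_trans (error_le _ _) _.
  - by move=> s sT; have [-> _] := xvE s (proj1 (andP sT)); exact: M_JL.
  - by rewrite mulrA.
  (* Gronwall yields [delta] with half the coefficient [K2]; the stated prefactor is larger by
     exactly the nonnegative term below. *)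
  rewrite ler_wpM2r ?expR_ge0// -subr_ge0.
  have -> : (eps * K1 + delta * K2) * t + eps * K3 * t ^+ 2 -
     (La * Num.sqrt (N%:R * W 0) * (eps * Num.sqrt (2 * X 0) + delta) * t +
      La * Num.sqrt (N%:R * W 0) * (eps * Num.sqrt (2 * V 0)) / 2 * t ^+ 2) =
     delta * (La * Num.sqrt (N%:R * W 0)) * t by rewrite /K1 /K2 /K3; field.
  by rewrite !mulr_ge0 ?sqrtr_ge0// ltW.
have max_le : Ex t + Ev t <= Num.sqrt N%:R * B t.
  apply: le_trans (lerD (max_error_le _ _ _) (max_error_le _ _ _)) _.
  by rewrite -mulrDr ler_wpM2l ?sqrtr_ge0.
split => //.
have Ev_le : Ev t <= Num.sqrt N%:R * B t.
  by apply: le_trans max_le; rewrite lerDr; exact: bigmax_ge_id.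
have Ev_le' : Ev t <= Num.sqrt N%:R * (l2_opnorm M * Num.sqrt (V t) + Num.sqrt (W t)).
  (* Both total velocities are conserved, so the sum of the velocity errors keeps its initial value,
     zero. *)
  apply: max_error_spread_le; rewrite sumrB -mulmx_sumr.
  rewrite -vtE -wtE (cs_sum_velocity xv_flow t0) (cs_sum_velocity yw_flow t0).
  rewrite v0E w0E mulmx_sumr -sumrB big1// => i _.
  by rewrite w_init subrr.
by case: (leP (B t)).
Qed.
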